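(* Let $\mathcal{C}\subseteq\mathbb{R}^n$ be nonempty, compact and convex, let $F:\mathcal{C}\to\mathbb{R}^n$ be monotone and $C^1$, and let $\{x_k\}_{k\ge 0}$ be a sequence generated by the Frank-Wolfe iteration $$x_{k+1}=x_k+\gamma_{k+1}(s_k-x_k),\qquad s_k\in\operatorname{argmin}_{s\in\mathcal{C}}\langle F(x_k),s\rangle,\qquad x_0\in\mathcal{C},$$ with step sizes $\gamma_k\in(0,1]$ $(k\ge 1)$ satisfying $\gamma_k\to 0$ and $\sum_{k=1}^\infty\gamma_k=\infty$. Let $\mathcal{S}=\{x\in\mathcal{C}:\langle F(x),z-x\rangle\ge 0\ \ \forall z\in\mathcal{C}\}$. Then every cluster point of the sequence $\{x_k\}$ belongs to $\mathcal{S}$. In particular, $\operatorname{dist}(x_k,\mathcal{S})\to 0$ as $k\to\infty$.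
   Context: $\|\cdot\|$ is the Euclidean norm and $\langle\cdot,\cdot\rangle$ the Euclidean inner product on $\mathbb{R}^n$. $F$ is monotone if $\langle F(x)-F(y),x-y\rangle\ge 0$ for all $x,y\in\mathcal{C}$. At each step $s_k$ is an arbitrary element of the (possibly non-singleton) argmin set. $\operatorname{dist}(x,\mathcal{S})=\inf_{z\in\mathcal{S}}\|x-z\|$. *)

(* Defs.v *)
(* Points of R^n are row vectors 'rV[R]_n. *)
From HB Require Import structures.
From mathcomp Require Import all_boot all_order all_algebra.
From mathcomp Require Import all_classical all_reals all_analysis.

Set Implicit Arguments.
Unset Strict Implicit.
Unset Printing Implicit Defensive.

Import Order.TTheory GRing.Theory Num.Theory.
Import numFieldNormedType.Exports.

Local Open Scope classical_set_scope.
Local Open Scope ring_scope.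

Definition inner {R : realType} {n : nat} (u v : 'rV[R]_n) : R :=
  \sum_(i < n) u ord0 i * v ord0 i.

(* The library norm `|u| on 'rV[R]_n is the sup norm; it induces the same
   topology as the Euclidean norm, so compactness, continuity and cluster
   points below are taken from the library. *)
Definition enorm {R : realType} {n : nat} (u : 'rV[R]_n) : R :=
  Num.sqrt (inner u u).

(* Extended-real valued, so that the distance to the empty set is +oo
   (inf set0 = 0 in R). *)
Definition edist_set {R : realType} {n : nat} (x : 'rV[R]_n)
    (S : set 'rV[R]_n) : \bar R :=
  ereal_inf [set (enorm (x - z))%:E | z in S].

Definition argmin_on {R : realType} {T : Type} (C : set T) (f : T -> R) :
    set T :=
  [set s | C s /\ forall z, C z -> f s <= f z].

Definition monotone_on {R : realType} {n : nat} (C : set 'rV[R]_n)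
    (F : 'rV[R]_n -> 'rV[R]_n) : Prop :=
  forall x y, C x -> C y -> 0 <= inner (F x - F y) (x - y).

(* F is C^1 on C, relative to C: C may have empty interior, and the values of F
   outside C are irrelevant. With row vectors the derivative at x is
   h |-> h *m DF x, that is, DF x i j is the derivative of the j-th component of
   F along the i-th coordinate. For C compact and convex this holds iff F
   coincides on C with a C^1 map on R^n (mean value theorem on segments and
   Whitney's extension theorem); in particular it holds if F is C^1 on an open
   neighbourhood of C. *)
Definition C1_on {R : realType} {n : nat} (C : set 'rV[R]_n)
    (F : 'rV[R]_n -> 'rV[R]_n) : Prop :=
  exists DF : 'rV[R]_n -> 'M[R]_n,
    {within C, continuous DF} /\
    forall x, C x -> forall e : R, 0 < e ->
      \forall y \near within C (nbhs x),
        enorm (F y - F x - (y - x) *m DF x) <= e * enorm (y - x).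

(* The step from x k to x k.+1 uses gamma k.+1; gamma 0 is never used. *)
Definition frank_wolfe {R : realType} {n : nat} (C : set 'rV[R]_n)
    (F : 'rV[R]_n -> 'rV[R]_n) (gamma : nat -> R)
    (x s : nat -> 'rV[R]_n) : Prop :=
  C (x 0%N) /\
  forall k : nat,
    argmin_on C (inner (F (x k))) (s k) /\
    x k.+1 = x k + gamma k.+1 *: (s k - x k).

Definition vi_solutions {R : realType} {n : nat} (C : set 'rV[R]_n)
    (F : 'rV[R]_n -> 'rV[R]_n) : set 'rV[R]_n :=
  [set x | C x /\ forall z, C z -> 0 <= inner (F x) (z - x)].

(* Main.v *)
Require Import Defs.
From HB Require Import structures.
From mathcomp Require Import all_boot all_order all_algebra.
From mathcomp Require Import all_classical all_reals all_analysis.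
From mathcomp Require Import ring lra zify.
Set Implicit Arguments.
Unset Strict Implicit.
Unset Printing Implicit Defensive.
Import Order.TTheory GRing.Theory Num.Theory.
Import numFieldNormedType.Exports.
Local Open Scope classical_set_scope.
Local Open Scope ring_scope.

(** The gap function G(u) = max_(z in C) <F u, u - z> decreases along the
continuous-time flow u' = s - u, but it may increase along the discrete
iteration: at a point where the minimiser of <F u, .> over C is not unique, G
need not decrease in the direction chosen by the algorithm. The proof therefore never
follows G forwards along the sequence. It looks backwards from a cluster point
where G is as large as it can be.

Let Omega be the set of cluster points of x_k, a compact subset of C, and
suppose that G is positive somewhere on Omega. Choose p in Omega maximising G
over Omega. Look at an index m with x_m very close to p, and go back to an
index k such that the steps from k to m add up to a small sigma. All iterates
in between are close to p, hence all directions s_i are close to the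
set A of minimisers of <F p, .> over C (argmin_near). As A is convex, so
is their weighted average (barycenter), and x_m - x_k is within o(sigma) of
sigma (a - p) for a single a in A. As x_k is itself close to Omega
(near_cluster), this gives y in Omega with y = p - sigma (a - p) + o(sigma)
(backward_step).

For this y, since <F p, p - a> = G(p),
  G(y) >= <F y, y - a>
        = <F y - F p, y - a> + <F p, y - p> + G(p).
Here <F p, y - p> = sigma G(p) + o(sigma). Moreover
sigma (y - a) = (1 + sigma) (y - p) + o(sigma), so by monotonicity and by
|F y - F p| = O(sigma) the first term is at least - o(sigma). Hence
G(y) >= (1 + sigma) G(p) - o(sigma) > G(p) for small sigma, contradicting the
choice of p. So G vanishes on Omega, that is, Omega consists of solutions
(cluster_solution), and the distance claim follows because a sequence in a
compact set approaches the set of its cluster points.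

The smoothness of F enters through the bound F y - F p = O(y - p) at each
point p (C1_calm). Estimates are made in the sup norm, which costs factors n
in the bounds on inner products. *)

(** * Inner product and norms on row vectors *)

Section inner_product.
Variables (R : realType) (n : nat).
Implicit Types (u v : 'rV[R]_n).

Lemma innerDl u v w : inner (u + v) w = inner u w + inner v w :> R.
Proof. by rewrite -big_split; apply: eq_bigr => i _ /=; rewrite mxE mulrDl. Qed.

Lemma innerC u v : inner u v = inner v u :> R.
Proof. by apply: eq_bigr => i _; rewrite mulrC. Qed.

Lemma innerZl a u v : inner (a *: u) v = a * inner u v :> R.
Proof. by rewrite mulr_sumr; apply: eq_bigr => i _ /=; rewrite mxE mulrA. Qed.

Lemma innerNl u v : inner (- u) v = - inner u v :> R.
Proof. by rewrite -scaleN1r innerZl mulN1r. Qed.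

Lemma innerBl u v w : inner (u - v) w = inner u w - inner v w :> R.
Proof. by rewrite innerDl innerNl. Qed.

Lemma innerDr u v w : inner w (u + v) = inner w u + inner w v :> R.
Proof. by rewrite innerC innerDl !(innerC w). Qed.

Lemma innerBr u v w : inner w (u - v) = inner w u - inner w v :> R.
Proof. by rewrite innerC innerBl !(innerC w). Qed.

Lemma innerNr u v : inner u (- v) = - inner u v :> R.
Proof. by rewrite innerC innerNl innerC. Qed.

Lemma innerZr a u v : inner u (a *: v) = a * inner u v :> R.
Proof. by rewrite innerC innerZl innerC. Qed.

Lemma coord_le_norm u i : `|u ord0 i| <= `|u|.
Proof.
rewrite [leRHS]/Num.norm /= mx_normrE.
exact: (le_bigmax_cond _ (fun ij : 'I_1 * 'I_n => `|u ij.1 ij.2|)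
   (j := (ord0, i))).
Qed.

Lemma norm_le_coord u (c : R) : 0 <= c ->
  (forall i, `|u ord0 i| <= c) -> `|u| <= c.
Proof.
move=> c0 uc; rewrite [leLHS]/Num.norm /= mx_normrE.
by apply: bigmax_le => // -[i j] _ /=; rewrite ord1.
Qed.

Lemma norm_inner u v : `|inner u v| <= n%:R * (`|u| * `|v|) :> R.
Proof.
rewrite (le_trans (ler_norm_sum _ _ _))//.
rewrite -[X in X%:R](card_ord n) -sum1_card natr_sum mulr_suml.
by apply: ler_sum => i _; rewrite mul1r normrM ler_pM// coord_le_norm.
Qed.

Lemma norm_le_enorm u : `|u| <= enorm u.
Proof.
apply: norm_le_coord; first exact: sqrtr_ge0.
move=> i; rewrite -sqrtr_sqr ler_wsqrtr// expr2 /inner (bigD1 i)//= lerDl.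
by apply: sumr_ge0 => j _; rewrite -expr2 sqr_ge0.
Qed.

Lemma enorm_le_norm u : enorm u <= n%:R * `|u|.
Proof.
rewrite -[leRHS]ger0_norm ?mulr_ge0// -sqrtr_sqr ler_wsqrtr//.
rewrite (le_trans (ler_norm _))// (le_trans (norm_inner _ _))//.
rewrite exprMn expr2 -mulrA [leRHS]mulrA ler_wpM2r ?sqr_ge0//.
by rewrite -expr2 -natrX ler_nat; case: (n) => // k; rewrite leq_pmulr.
Qed.

Lemma norm_mulmx u (A : 'M[R]_n) : `|u *m A| <= n%:R * (`|u| * `|A|).
Proof.
apply: norm_le_coord; first by rewrite !mulr_ge0.
move=> i; rewrite mxE (le_trans (ler_norm_sum _ _ _))//.
rewrite -[X in X%:R](card_ord n) -sum1_card natr_sum mulr_suml.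
apply: ler_sum => j _; rewrite mul1r normrM ler_pM// ?coord_le_norm//.
rewrite [leRHS]/Num.norm /= mx_normrE.
exact: (le_bigmax_cond _ (fun ij : 'I_n * 'I_n => `|A ij.1 ij.2|)
   (j := (j, i))).
Qed.

Lemma cvg_inner {T} (G : set_system T) {FG : Filter G}
    (f g : T -> 'rV[R]_n) u v :
  f @ G --> u -> g @ G --> v -> inner (f t) (g t) @[t --> G] --> inner u v.
Proof.
move=> fu gv; rewrite /inner.
have coord (h : T -> 'rV[R]_n) (w : 'rV[R]_n) i :
    h @ G --> w -> h t ord0 i @[t --> G] --> w ord0 i.
  move=> hw; apply: (@cvg_comp _ _ _ h (fun M : 'rV[R]_n => M ord0 i)).
    exact: hw.
  exact: coord_continuous.
elim: (index_enum _) => [|i r IH].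
  by rewrite big_nil; under eq_fun do rewrite big_nil; exact: cvg_cst.
rewrite big_cons; under eq_fun do rewrite big_cons.
by apply: cvgD => //; apply: cvgM; exact: coord.
Qed.

(** The first-order effect, on the gap towards [a], of the backward step
[y = p - sigma (a - p) + r]: apart from the terms in [r], the gap [<P, p - a>]
grows by the factor [1 + sigma]. Since
[sigma (y - a) = (1 + sigma) (y - p) - r], the change of the operator from [P]
to [Q] enters only through [<Q - P, y - p>], which has a sign. *)
Lemma gap_backward (p y a P Q : 'rV[R]_n) (sigma : R) : 0 < sigma ->
  0 <= inner (Q - P) (y - p) ->
  (1 + sigma) * inner P (p - a) <= inner Q (y - a)
    - inner P (y - p + sigma *: (a - p))
    + sigma^-1 * inner (Q - P) (y - p + sigma *: (a - p)).
Proof.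
move=> sg0 mon; rewrite -subr_ge0.
set lhs := (X in 0 <= X).
suff -> : lhs = (1 + sigma) / sigma * inner (Q - P) (y - p).
  by rewrite mulr_ge0// divr_ge0 ?addr_ge0// ltW.
rewrite /lhs !(innerBl, innerBr, innerDr, innerNr, innerZr).
by field; exact: lt0r_neq0.
Qed.

End inner_product.

(** * Regularity of the operator *)

Section regularity.
Variables (R : realType) (n : nat).

Lemma near_dist_le (V : normedModType R) (x : V) (e : R) : 0 < e ->
  \forall y \near x, `|x - y| <= e.
Proof. by move=> e0; apply/nbhs_normP; exists e => //= y /ltW. Qed.

Lemma near_within_dist (A P : set 'rV[R]_n) (p : 'rV[R]_n) :
  (\forall y \near within A (nbhs p), P y) ->
  exists2 d : R, 0 < d & forall y : 'rV[R]_n, `|p - y| < d -> A y -> P y.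
Proof.
move=> H; have /nbhs_normP[d d0 Hd] : nbhs p (fun y => A y -> P y) := H.
by exists d.
Qed.

(** A derivative at [x] is bounded, and the remainder is of lower order. *)
Lemma C1_calm (C : set 'rV[R]_n) (F : 'rV[R]_n -> 'rV[R]_n) x :
  C1_on C F -> C x ->
  exists2 L : R, 0 <= L &
    \forall y \near within C (nbhs x), `|F y - F x| <= L * `|y - x|.
Proof.
move=> [DF [_ HF]] Cx; exists (n%:R * (1 + `|DF x|)).
  by rewrite mulr_ge0// addr_ge0.
apply: filterS (HF x Cx 1 ltr01) => y; rewrite mul1r => Hy.
rewrite -[F y - F x](subrK ((y - x) *m DF x)).
rewrite (le_trans (ler_normD _ _))// mulrDr mulr1 mulrDl lerD//.
  by rewrite (le_trans (norm_le_enorm _))// (le_trans Hy)// enorm_le_norm.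
by rewrite (le_trans (norm_mulmx _ _))// -mulrA (mulrC `|y - x|).
Qed.

Lemma C1_continuous (C : set 'rV[R]_n) (F : 'rV[R]_n -> 'rV[R]_n) x :
  C1_on C F -> C x ->
  F y @[y --> within C (nbhs x)] --> F x.
Proof.
move=> C1 Cx; have [L L0 HL] := C1_calm C1 Cx.
apply/cvgrPdist_le => e e0.
have e'0 : 0 < e / (L + 1) by rewrite divr_gt0// ltr_wpDl.
have near_x : \forall y \near within C (nbhs x), `|x - y| <= e / (L + 1).
  by apply: filterS (near_dist_le x e'0) => y + _.
apply: filterS2 HL near_x => y Hy xy.
rewrite distrC (le_trans Hy)// distrC (le_trans (ler_wpM2l L0 xy))//.
by rewrite mulrA ler_pdivrMr ?ltr_wpDl// mulrDr mulr1 mulrC lerDl ltW.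
Qed.

End regularity.

(** * Compactness and convexity *)

Section compact_convex.
Variables (R : realType) (n : nat).

Lemma compact_diameter (C : set 'rV[R]_n) : compact C ->
  exists2 D : R, 0 < D & forall u v, C u -> C v -> `|u - v| <= D.
Proof.
move=> /compact_bounded /pinfty_ex_gt0[M M0 CM].
exists (M + M); first exact: addr_gt0.
by move=> u v Cu Cv; rewrite (le_trans (ler_normB _ _))// lerD//; exact: CM.
Qed.

(** Upper semicontinuity of the argmin of a linear form. A point [z] of [C] that
is not optimal for [q] is beaten by some [w]; by continuity [w] still beats all
points near [z] for all forms near [q], and compactness of [C] makes this
uniform in [z]. *)
Lemma argmin_near {T} (G : set_system T) {FG : Filter G} (C : set 'rV[R]_n)
    (p : T -> 'rV[R]_n) (q : 'rV[R]_n) (e : R) :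
  compact C -> p @ G --> q -> 0 < e ->
  \forall t \near G, forall s, argmin_on C (inner (p t)) s ->
    exists2 a, argmin_on C (inner q) a & `|s - a| <= e.
Proof.
move=> /compact_near_coveringP cC pq e0.
pose P t s := argmin_on C (inner (p t)) s ->
    exists2 a, argmin_on C (inner q) a & `|s - a| <= e.
suff : \near G, C `<=` P G.
  by apply: filterS => t H s As; apply: H => //; exact: As.1.
apply: cC => z Cz; rewrite {}/P.
have [Az|] := pselect (argmin_on C (inner q) z).
  have nz : \forall s \near z & t \near G, `|z - s| <= e.
    exists ([set s | `|z - s| <= e], setT) => [|[s t] []//]; split=> /=.
      exact: (near_dist_le z e0).
    exact: filterT.
  apply: filterS nz => -[s t] /= zs _.
  by exists z => //; rewrite distrC.
move=> nAz.
have [w Cw qw] : exists2 w, C w & inner q w < inner q z.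
  apply: contrapT => H; apply: nAz; split=> // w Cw.
  by rewrite leNgt; apply/negP => wz; apply: H; exists w.
have ip : inner (p st.2) (st.1 - w) @[st --> filter_prod (nbhs z) G]
    --> inner q (z - w).
  apply: cvg_inner; last by apply: cvgB; [exact: cvg_fst|exact: cvg_cst].
  by apply: cvg_comp pq; exact: cvg_snd.
have : 0 < inner q (z - w) by rewrite innerBr subr_gt0.
move/(cvgr_gt _ ip); apply: filterS => -[s t] /=.
rewrite innerBr subr_gt0 => ws [Cs /(_ w Cw)].
by rewrite leNgt ws.
Qed.

(** A point of [C] that is not a cluster point has a neighbourhood that [f]
eventually avoids; finitely many of these, together with finitely many balls of
radius [e] around cluster points, cover [C]. *)
Lemma near_cluster {T} (G : set_system T) {FG : Filter G} (V : normedModType R)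
   (C : set V) (f : T -> V) (e : R) :
  compact C -> (\forall t \near G, C (f t)) -> 0 < e ->
  \forall t \near G, exists2 y, cluster (f @ G) y & `|f t - y| <= e.
Proof.
move=> /compact_near_coveringP cC Cf e0.
pose P t z := f t = z -> exists2 y, cluster (f @ G) y & `|z - y| <= e.
suff PC : \near G, C `<=` P G.
  by apply: filterS2 Cf PC => t Ct /(_ _ Ct); apply.
apply: cC => z Cz; rewrite {}/P.
have [Az|] := pselect (cluster (f @ G) z).
  have nz : \forall s \near z & t \near G, `|z - s| <= e.
    exists ([set s | `|z - s| <= e], setT) => [|[s t] []//]; split=> /=.
      exact: (near_dist_le z e0).
    exact: filterT.
  by apply: filterS nz => -[s t] /= zs _; exists z => //; rewrite distrC.
move=> nAz.
have [A [B [GA zB AB]]] :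
    exists A B, [/\ (f @ G) A, nbhs z B & A `&` B = set0].
  apply: contrapT => H; apply: nAz => A B GA zB.
  by apply/set0P/eqP => AB; apply: H; exists A, B.
exists (B, f @^-1` A) => [|[s t] [/= Bs At] fts]; first by split.
have : (A `&` B) (f t) by split => //; rewrite fts.
by rewrite AB.
Qed.

Lemma argmin_convex (C : set 'rV[R]_n) p : convex_set C ->
  convex_set (argmin_on C (inner p)).
Proof.
move=> cC x y k /set_mem[Cx xm] /set_mem[Cy ym]; apply/mem_set; split.
  by apply/set_mem/cC; exact/mem_set.
move=> z Cz; rewrite /conv/= innerDr !innerZr.
have k0 : 0 <= k%:num by [].
have k1 : 0 <= 1 - k%:num by rewrite subr_ge0.
have := xm z Cz; have := ym z Cz; rewrite /unstable.onem; nra.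
Qed.

(** Distance to a convex set is a convex function, in unnormalised form: the
total weight may be zero, when the range is empty. *)
Lemma barycenter (A : set 'rV[R]_n) (g : nat -> R) (v : nat -> 'rV[R]_n)
    (e : R) k m :
  convex_set A -> A !=set0 -> (forall i, 0 < g i) -> (k <= m)%N ->
  (forall i, (k <= i < m)%N -> exists2 a, A a & `|v i - a| <= e) ->
  exists2 a, A a &
    `|\sum_(k <= i < m) g i *: v i - (\sum_(k <= i < m) g i) *: a|
      <= e * \sum_(k <= i < m) g i.
Proof.
move=> cA [a0 Aa0] g0 km; rewrite -(subnK km); elim: (m - k)%N => [|l IH] Hv.
  by exists a0 => //; rewrite add0n !big_geq// scale0r subr0 normr0 mulr0.
have [i /andP[ki il]|a Aa aP] := IH.
  by apply: Hv; rewrite ki addSn ltnS ltnW.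
have [|b Ab bP] := Hv (l + k)%N; first by rewrite leq_addl addSn ltnSn.
rewrite addSn !big_nat_recr ?leq_addl//=.
have : 0 <= \sum_(k <= i < l + k) g i by apply: sumr_ge0 => i _; exact: ltW.
move: (\sum_(k <= i < l + k) g i) aP => w.
move: (\sum_(k <= i < l + k) g i *: v i) => V aP w0.
have c0 := g0 (l + k)%N.
have wc : 0 < w + g (l + k)%N by rewrite ltr_wpDl.
have q0 : 0 <= w / (w + g (l + k)%N) by rewrite divr_ge0// ltW.
have q1 : w / (w + g (l + k)%N) <= 1 by rewrite ler_pdivrMr// mul1r lerDl ltW.
exists (conv (Itv01 q0 q1) (a : convex_lmodType 'rV[R]_n) b).
  by apply/set_mem/cA; exact/mem_set.
rewrite /conv/= /unstable.onem.
have -> : V + g (l + k)%N *: v (l + k)%N - (w + g (l + k)%N) *: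
   ((w / (w + g (l + k)%N)) *: a + (1 - w / (w + g (l + k)%N)) *: b) =
   (V - w *: a) + g (l + k)%N *: (v (l + k)%N - b).
  apply/rowP => j; rewrite !mxE; field; exact: lt0r_neq0.
rewrite (le_trans (ler_normD _ _))// mulrDr lerD// normrZ gtr0_norm// mulrC.
by rewrite ler_wpM2r// ltW.
Qed.

(** Going back from [m] one step of length at most [t] at a time, the distance
covered cannot jump over the interval from [t] to [2 * t]. *)
Lemma exists_block (g : nat -> R) (t : R) K m : 0 < t -> (K <= m)%N ->
  (forall i, (K <= i)%N -> g i <= t) -> t <= \sum_(K <= i < m) g i ->
  exists k, [/\ (K <= k)%N, (k <= m)%N & t <= \sum_(k <= i < m) g i <= 2 * t].
Proof.
move=> t0 Km; have [d] := ubnP (m - K)%N.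
elim: d K Km => // d IH K Km; rewrite ltnS => dK gt tK.
move: Km; rewrite leq_eqVlt => /predU1P[KM|Km].
  by move: tK; rewrite KM big_geq// leNgt t0.
have [tS|St] := leP t (\sum_(K.+1 <= i < m) g i).
  have [| |||k [Kk km kt]] := IH K.+1 => //.
  - by move: dK Km; lia.
  - by move=> i /ltnW; exact: gt.
  by exists k; split=> //; exact: ltnW.
exists K; split => //; first exact: ltnW.
by rewrite tK/= big_ltn// mulr2n mulrDl mul1r lerD ?gt// ltW.
Qed.

End compact_convex.

(** * Frank-Wolfe iterates *)

Section frank_wolfe_iterates.
Variables (R : realType) (n : nat).
Variables (C : set 'rV[R]_n) (F : 'rV[R]_n -> 'rV[R]_n) (gamma : nat -> R)
  (x s : nat -> 'rV[R]_n).
Hypotheses (cptC : compact C) (cvxC : convex_set C)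
  (fw : frank_wolfe C F gamma x s).
Hypothesis gamma_range : forall k : nat, (0 < k)%N -> 0 < gamma k <= 1.

Lemma fw_mem k : C (x k).
Proof.
elim: k => [|k IH]; first exact: fw.1.
have [[Cs _] ->] := fw.2 k.
have /andP[/ltW g0 g1] := gamma_range (ltn0Sn k).
have := cvxC (Itv01 g0 g1) (mem_set Cs) (mem_set IH).
move=> /set_mem; rewrite /conv/= /unstable.onem.
congr C; apply/rowP => j; rewrite !mxE; ring.
Qed.

(** The iteration telescoped, with every direction [s i - x i] shifted by the
same [p], which turns it into [s i] up to an error [p - x i]. *)
Lemma fw_displacement p k m : (k <= m)%N ->
  \sum_(k <= i < m) gamma i.+1 *: (s i - x i + p) =
  x m - x k + (\sum_(k <= i < m) gamma i.+1) *: p.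
Proof.
move=> km; rewrite -(subnK km); elim: (m - k)%N => [|l IH].
  by rewrite add0n !big_geq// scale0r subrr addr0.
rewrite addSn !big_nat_recr ?leq_addl//= IH.
have [_ ->] := fw.2 (l + k)%N.
by apply/rowP => j; rewrite !mxE; ring.
Qed.

Lemma fw_dist_le (D : R) k m : (forall u v, C u -> C v -> `|u - v| <= D) ->
  (k <= m)%N -> `|x m - x k| <= D * \sum_(k <= i < m) gamma i.+1.
Proof.
move=> CD km.
have := fw_displacement 0 km; rewrite scaler0 addr0 => <-.
rewrite mulr_sumr (le_trans (ler_norm_sum _ _ _))//; apply: ler_sum => i _.
rewrite addr0 normrZ gtr0_norm; last by have /andP[] := gamma_range (ltn0Sn i).
rewrite mulrC ler_wpM2r//; first by have /andP[/ltW] := gamma_range (ltn0Sn i).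
by apply: CD; [exact: (fw.2 i).1.1|exact: fw_mem].
Qed.

Hypothesis contF : forall y, C y -> F z @[z --> within C (nbhs y)] --> F y.
Hypothesis gamma_cvg0 : gamma k @[k --> \oo] --> (0 : R).
Hypothesis gamma_series : (\sum_(1 <= k <oo) (gamma k)%:E = +oo)%E.

Lemma gamma_tail K (t : R) : exists M, forall m, (M <= m)%N ->
  t <= \sum_(K <= i < m) gamma i.+1.
Proof.
have : (fun m => \sum_(1 <= k < m) (gamma k)%:E)%E @ \oo --> +oo%E.
  rewrite -gamma_series; apply: is_cvg_nneseries => k k1 _.
  by rewrite lee_fin; have /andP[/ltW] := gamma_range k1.
move=> /cvgeyPge/(_ (t + \sum_(1 <= k < K.+1) gamma k)) [M _ HM].
exists (maxn M K) => m; rewrite geq_max => /andP[Mm Km].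
have := HM m.+1 (leq_trans Mm (leqnSn _)) => /=.
rewrite sumEFin lee_fin [leRHS](big_cat_nat (n := K.+1))//= [leLHS]addrC lerD2l.
by rewrite big_add1.
Qed.

Notation Om := (cluster (x k @[k --> \oo])).

Lemma cluster_fw_sub : Om `<=` C.
Proof.
move=> p; rewrite clusterE => Op.
rewrite ((closure_id C).1 (compact_closed (@norm_hausdorff _ _) cptC)).
by apply: Op; exists 0%N => // k _; exact: fw_mem.
Qed.

(** Cluster points have approximate backward orbits: up to an error [e * sigma],
[p] is reached from another cluster point [y] by moving for time [sigma] towards
one single minimiser [a] for [F p], although the iterates that lead from near
[y] to near [p] use many directions, which need not be minimisers for [F p]. *)
Lemma backward_step (p : 'rV[R]_n) (e : R) : Om p -> 0 < e ->
  exists (y : 'rV[R]_n) (sigma : R) (a : 'rV[R]_n),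
    [/\ Om y, 0 < sigma <= e, argmin_on C (inner (F p)) a &
        `|y - p + sigma *: (a - p)| <= e * sigma].
Proof.
move=> Op e0.
have Cp := cluster_fw_sub Op.
have [D D0 CD] := compact_diameter cptC.
have e8 : 0 < e / 8 by rewrite divr_gt0.
have [d d0 usc] := near_within_dist (argmin_near cptC (contF Cp) e8).
(* [d1] bounds how far the iterates of a block stray from its end [x m]; the
   total step size of the block is between [t] and [2 * t]; [eta] bounds the
   errors at its two ends, where [x m] stands for [p] and [x k] for [y]. These
   errors have to be small relative to [t]. *)
pose d1 := Num.min (d / 3) (e / 8).
have d10 : 0 < d1 by rewrite lt_min !divr_gt0.
have d1d : d1 <= d / 3 by rewrite ge_min lexx.
have d1e : d1 <= e / 8 by rewrite ge_min lexx orbT.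
pose t := Num.min (e / 2) (d1 / (2 * D)).
have t0 : 0 < t by rewrite lt_min !divr_gt0// mulr_gt0.
have te : t <= e / 2 by rewrite ge_min lexx.
have tD : D * (2 * t) <= d1.
  rewrite (_ : D * _ = t * (2 * D)); last by ring.
  by rewrite -ler_pdivlMr ?mulr_gt0// ge_min lexx orbT.
pose eta := Num.min d1 (e * t / 8).
have eta0 : 0 < eta by rewrite lt_min d10 divr_gt0// mulr_gt0.
have etad : eta <= d1 by rewrite ge_min lexx.
have etat : eta <= e * t / 8 by rewrite ge_min lexx orbT.
clearbody eta t d1.
have : \forall k \near \oo, gamma k.+1 <= t /\
    exists2 y : 'rV[R]_n, Om y & `|x k - y| <= eta.
  near=> k; split.
    have : `|0 - gamma k.+1| <= t.
      near: k; move/cvgrPdist_le : gamma_cvg0 => /(_ _ t0)[N _ HN].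
      by exists N => // k /= Nk; apply: HN => /=; exact: leqW.
    by rewrite sub0r normrN; apply: le_trans; exact: ler_norm.
  near: k; apply: near_cluster cptC _ eta0; exact: nearW fw_mem.
move=> [K _ HK].
have [M HM] := gamma_tail K t.
have [_ [[m MKm <-] mp]] : [set x m | m in [set m | (maxn M K <= m)%N]]
    `&` [set z | `|p - z| <= eta] !=set0.
  apply: Op; last exact: (near_dist_le p eta0).
  by exists (maxn M K) => // m /= ?; exists m.
rewrite /= in mp; move: MKm; rewrite /= geq_max => /andP[Mm Km].
have gt i : (K <= i)%N -> gamma i.+1 <= t by move=> /HK[].
have [k [Kk km /andP[tW Wt]]] := exists_block t0 Km gt (HM _ Mm).
have [_ [y Oy xy]] := HK _ Kk.
have near_i i : (k <= i < m)%N -> `|p - x i| <= d1 + eta.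
  move=> /andP[ki im]; rewrite -(subrK (x m) p) -addrA addrC.
  rewrite (le_trans (ler_normD _ _))// lerD//.
  rewrite (le_trans (fw_dist_le CD (ltnW im)))// (le_trans _ tD)//.
  rewrite ler_wpM2l ?(ltW D0)// (le_trans _ Wt)//.
  rewrite [leRHS](big_cat_nat (n := i))//= ?(ltnW im)// lerDr.
  by apply: sumr_ge0 => j _; have /andP[/ltW] := gamma_range (ltn0Sn j).
have near_s i : (k <= i < m)%N -> exists2 a, argmin_on C (inner (F p)) a &
    `|(s i - x i + p) - a| <= 3 / 8 * e.
  move=> kim; have xi := near_i i kim.
  have [a Aa sa] : exists2 a, argmin_on C (inner (F p)) a &
      `|s i - a| <= e / 8.
    apply: (usc (x i)); last exact: (fw.2 i).1; last exact: fw_mem.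
    by apply: le_lt_trans xi _; lra.
  exists a => //; rewrite (_ : _ - a = (s i - a) + (p - x i)); last first.
    by apply/rowP => j; rewrite !mxE; ring.
  by apply: le_trans (ler_normD _ _) (le_trans (lerD sa xi) _); lra.
have A0 : argmin_on C (inner (F p)) !=set0.
  have [a Aa _] : exists2 a, argmin_on C (inner (F p)) a &
      `|s m - a| <= e / 8.
    apply: (usc (x m)); last exact: (fw.2 m).1; last exact: fw_mem.
    by apply: le_lt_trans mp _; lra.
  by exists a.
have g0 i : 0 < gamma i.+1 by have /andP[] := gamma_range (ltn0Sn i).
have [a Aa] := barycenter (argmin_convex cvxC) A0 g0 km near_s.
rewrite fw_displacement//.
move: (\sum_(k <= i < m) gamma i.+1) tW Wt => W tW Wt aP.
exists y, W, a; split => //.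
  by rewrite (lt_le_trans t0 tW)/=; lra.
rewrite (_ : _ + _ = (y - x k) + (x m - p)
    - (x m - x k + W *: p - W *: a)); last first.
  by apply/rowP => j; rewrite !mxE; ring.
rewrite (le_trans (ler_normB _ _))//.
have := ler_normD (y - x k) (x m - p).
rewrite (distrC y) (distrC (x m)).
have : e * t <= e * W by rewrite ler_wpM2l// ltW.
lra.
Unshelve. all: by end_near. Qed.

End frank_wolfe_iterates.

(** * Convergence *)

(** The gap is maximised over its point and its competitor at once: as a
function of the pair it is visibly continuous. *)
Lemma max_gap (R : realType) (n : nat) (Om C : set 'rV[R]_n)
    (F : 'rV[R]_n -> 'rV[R]_n) :
  compact Om -> compact C -> Om `<=` C -> Om !=set0 -> C !=set0 ->
  (forall y, C y -> F z @[z --> within C (nbhs y)] --> F y) ->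
  exists p z, [/\ Om p, C z & forall u v, Om u -> C v ->
    inner (F u) (u - v) <= inner (F p) (p - z)].
Proof.
move=> cptO cptC OC [q Oq] [w Cw] contF.
pose phi (u : 'rV[R]_n * 'rV[R]_n) := inner (F u.1) (u.1 - u.2).
have phi_cont : {within Om `*` C, continuous phi}.
  apply/subspace_continuousP => -[u v] [/= Ou Cv].
  have ufst : fst @ within (Om `*` C) (nbhs (u, v)) --> u.
    apply: cvg_trans (cvg_fst (F := nbhs u) (G := nbhs v)).
    by apply: cvg_app; exact: cvg_within.
  have usnd : snd @ within (Om `*` C) (nbhs (u, v)) --> v.
    apply: cvg_trans (cvg_snd (F := nbhs u) (G := nbhs v)).
    by apply: cvg_app; exact: cvg_within.
  apply: cvg_inner; last exact: cvgB.
  apply: cvg_comp (contF u (OC _ Ou)).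
  move=> A /= uA; have := ufst _ uA.
  rewrite /= /nbhs /= /within /=; apply: filterS => -[a b] /= H [Oa Cb].
  by apply: H => //; exact: OC.
have [[p z] /set_mem[/= Op Cz] pmax] : exists2 c, c \in Om `*` C &
    forall t, t \in Om `*` C -> phi t <= phi c.
  apply: compact_EVT_max => //; first by exists (q, w).
  exact: compact_setX.
exists p, z; split=> // u v Ou Cv.
by apply: (pmax (u, v)); apply/mem_set.
Qed.

(** By contradiction, at a cluster point [p] with the largest gap: the backward
step from [p] leads to a cluster point with a larger one. *)
Lemma cluster_solution (R : realType) (n : nat) (C : set 'rV[R]_n)
    (F : 'rV[R]_n -> 'rV[R]_n) (gamma : nat -> R) (x s : nat -> 'rV[R]_n) :
  compact C -> convex_set C -> monotone_on C F -> C1_on C F ->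
  frank_wolfe C F gamma x s ->
  (forall k : nat, (0 < k)%N -> 0 < gamma k <= 1) ->
  gamma k @[k --> \oo] --> (0 : R) ->
  (\sum_(1 <= k <oo) (gamma k)%:E = +oo)%E ->
  cluster (x k @[k --> \oo]) `<=` vi_solutions C F.
Proof.
move=> cptC cvxC monF F_C1 fw gamma_range gamma_cvg0 gamma_series.
have contF y : C y -> F z @[z --> within C (nbhs y)] --> F y.
  exact: C1_continuous.
have Om_sub : cluster (x k @[k --> \oo]) `<=` C.
  exact: (cluster_fw_sub cptC cvxC fw gamma_range).
set Om := cluster _ in Om_sub *.
move=> q Oq; split; first exact: Om_sub.
move=> w Cw; rewrite leNgt; apply/negP => Fqw.
have cptO : compact Om.
  apply: subclosed_compact cptC Om_sub.
  by rewrite /Om clusterE; apply: closed_bigI => A _; exact: closed_closure.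
have [p [z [Op Cz pmax]]] : exists p z : 'rV[R]_n, [/\ Om p, C z &
    forall u v, Om u -> C v ->
    inner (F u) (u - v) <= inner (F p) (p - z)].
  by apply: max_gap => //; [exists q|exists w].
have Cp := Om_sub _ Op.
have G0 : 0 < inner (F p) (p - z).
  by rewrite (lt_le_trans _ (pmax _ _ Oq Cw))// -[q - w]opprB innerNr oppr_gt0.
have [G GE] : exists G, G = inner (F p) (p - z) by eexists.
rewrite -GE in pmax G0.
have [L L0 /near_within_dist[d d0 HL]] := C1_calm F_C1 Cp.
have [D D0 CD] := compact_diameter cptC.
(* [e * B * sg] will bound the terms of [gap_backward] that contain the error
   of the backward step; [e <= 1] and [e * (1 + D) < d] keep that step inside
   the neighbourhood of [p] where the bound [L] on the variation of [F] holds. *)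
pose B := n%:R * (`|F p| + L * (1 + D)) : R.
have B0 : 0 <= B by rewrite mulr_ge0// addr_ge0// mulr_ge0// addr_ge0// ltW.
pose e := Num.min (Num.min 1 (d / (2 * (1 + D)))) (G / (2 * (B + 1))).
have D1 : 0 < 1 + D by rewrite addr_gt0.
have e0 : 0 < e by rewrite !lt_min ltr01/= !divr_gt0// mulr_gt0// ltr_wpDl.
have e1 : e <= 1 by rewrite !ge_min lexx.
have ed : e * (1 + D) < d.
  have : e * (2 * (1 + D)) <= d.
    by rewrite -ler_pdivlMr ?mulr_gt0// !ge_min lexx orbT.
  by nra.
have eG : e * B < G.
  have : e * (2 * (B + 1)) <= G.
    by rewrite -ler_pdivlMr ?mulr_gt0// ?ltr_wpDl// !ge_min lexx orbT.
  by nra.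
have [y [sg [a [Oy /andP[sg0 sge] [Ca amin] rP]]]] := backward_step cptC cvxC
  fw gamma_range contF gamma_cvg0 gamma_series Op e0.
have Cy := Om_sub _ Oy.
have aG : inner (F p) (p - a) = G.
  apply/eqP; rewrite eq_le pmax//= GE !innerBr lerD2l lerN2; exact: amin.
set r := y - p + sg *: (a - p) in rP.
have yp : `|y - p| <= sg * (1 + D).
  rewrite (_ : y - p = r - sg *: (a - p)); last by rewrite addrK.
  rewrite (le_trans (ler_normB _ _))// normrZ gtr0_norm// mulrDr mulr1 lerD//.
    by rewrite (le_trans rP)// ler_piMl// ltW.
  by rewrite ler_wpM2l ?CD// ltW.
have Dl : `|F y - F p| <= L * (sg * (1 + D)).
  rewrite (le_trans (HL y _ Cy))//= ?ler_wpM2l// distrC.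
  rewrite (le_lt_trans yp)// (le_lt_trans _ ed)// ler_wpM2r// ltW//.
have := gap_backward a sg0 (monF _ _ Cy Cp); rewrite -/r aG.
have ya := pmax y a Oy Ca.
have i1 : - inner (F p) r <= n%:R * (`|F p| * (e * sg)).
  rewrite (le_trans (ler_norm _))// normrN (le_trans (norm_inner _ _))//.
  by rewrite ler_wpM2l// ler_wpM2l.
have i2 : sg^-1 * inner (F y - F p) r <= n%:R * (L * (1 + D) * (e * sg)).
  rewrite mulrC ler_pdivrMr// (le_trans (ler_norm _))//.
  rewrite (le_trans (norm_inner _ _))//.
  rewrite [leRHS](_ : _ = n%:R * (L * (sg * (1 + D)) * (e * sg))); last by ring.
  by rewrite ler_wpM2l// ler_pM.
have : e * B * sg < G * sg by rewrite ltr_pM2r.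
have : e * B * sg =
    n%:R * (`|F p| * (e * sg)) + n%:R * (L * (1 + D) * (e * sg)).
  by rewrite /B; ring.
lra.
Qed.

(** * Distance to the solution set *)

Lemma cvg_edist_set (R : realType) (n : nat) (S : set 'rV[R]_n)
    (u : nat -> 'rV[R]_n) :
  (forall e : R, 0 < e ->
    \forall k \near \oo, exists2 y, S y & `|u k - y| <= e) ->
  edist_set (u k) S @[k --> \oo] --> 0%E.
Proof.
move=> uS.
have dist_le (e : R) : 0 < e ->
    \forall k \near \oo, (0 <= edist_set (u k) S <= e%:E)%E.
  move=> e0; have e'0 : 0 < e / (n%:R + 1) by rewrite divr_gt0// ltr_wpDl.
  apply: filterS (uS _ e'0) => k [y Sy uy]; apply/andP; split.
    by apply: le_ereal_inf_tmp => _ [z _ <-]; rewrite lee_fin sqrtr_ge0.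
  apply: ereal_inf_le; exists (enorm (u k - y))%:E; first by exists y.
  rewrite lee_fin (le_trans (enorm_le_norm _))//.
  rewrite (le_trans (ler_wpM2l _ uy))// mulrA ler_pdivrMr ?ltr_wpDl//.
  by rewrite mulrDr mulr1 mulrC lerDl ltW.
apply/fine_cvgP; split.
  apply: filterS (dist_le 1 ltr01) => k /andP[d0 d1].
  by rewrite ge0_fin_numE// (le_lt_trans d1)// ltry.
apply/cvgrPdist_le => e e0.
apply: filterS (dist_le e e0) => k /andP[d0 de].
have dfin : edist_set (u k) S \is a fin_num.
  by rewrite ge0_fin_numE// (le_lt_trans de)// ltry.
by rewrite /= sub0r normrN ger0_norm ?fine_ge0// -lee_fin fineK.
Qed.

Theorem corollary7 (R : realType) (n : nat) (C : set 'rV[R]_n)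
    (F : 'rV[R]_n -> 'rV[R]_n) (gamma : nat -> R) (x s : nat -> 'rV[R]_n)
    (C_nonempty : C !=set0) (C_compact : compact C) (C_convex : convex_set C)
    (F_monotone : monotone_on C F) (F_C1 : C1_on C F)
    (x_fw : frank_wolfe C F gamma x s)
    (gamma_range : forall k : nat, (0 < k)%N -> 0 < gamma k <= 1)
    (gamma_cvg0 : gamma k @[k --> \oo] --> (0 : R))
    (gamma_series : (\sum_(1 <= k <oo) (gamma k)%:E = +oo)%E) :
  cluster (x k @[k --> \oo]) `<=` vi_solutions C F /\
  edist_set (x k) (vi_solutions C F) @[k --> \oo] --> 0%E.
Proof.
have solution : cluster (x k @[k --> \oo]) `<=` vi_solutions C F.
  exact: (cluster_solution C_compact C_convex F_monotone F_C1 x_fw gamma_range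
    gamma_cvg0 gamma_series).
split => //; apply: cvg_edist_set => e e0.
have xC k : C (x k) by exact: fw_mem C_convex x_fw gamma_range k.
apply: filterS (near_cluster C_compact (nearW _ xC) e0) => k [y Oy xy].
by exists y; first exact: solution.
Qed.
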